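(* There is an absolute constant $c_2>0$ such that the following holds. Suppose that $\epsilon\leq c_2/2$. Then any $(L,\epsilon,T,M,r)$-smoother on $\mathbb{R}^d$ satisfying $\mathsf{TICF}$ which makes at most $T=\mathrm{poly}(d,L,\epsilon^{-1})$ queries at a distance at most $r=\mathcal{O}(\epsilon)$ from the input point, and returns vectors of norm at most $M=\mathrm{poly}(d,L,\epsilon^{-1})$, must correspond to a smooth approximation $\tilde f$ with Lipschitz gradient parameter at least $L=\tilde\Omega(\sqrt d/\epsilon)$.
   Context: Asymptotic notation: for nonnegative functions, $f=\mathcal{O}(g)$ if $f\leq c\cdot g$ for some constant $c>0$; $f=\tilde{\mathcal{O}}(g)$ if $f=\mathcal{O}(g\log(g+1))$; $f=\tilde\Omega(g)$ if $g=\tilde{\mathcal{O}}(f)$; $\mathrm{poly}(\cdot)$ denotes a polynomial bound. The constants hidden in the conclusion depend only on those in the $\mathrm{poly}$ and $\mathcal{O}$ hypotheses. $\|\cdot\|$ is the Euclidean norm on $\mathbb{R}^d$, $\|f-g\|_\infty=\sup_{\mathbf{x}}|f(\mathbf{x})-g(\mathbf{x})|$. Local oracle: an oracle $\mathbb{O}$ assigns to every function $f$ and point $\mathbf{x}$ a quantity $\mathbb{O}_f(\mathbf{x})$; it is local if for any $\mathbf{x}$ and any $f,g$ that are equal over some neighborhood of $\mathbf{x}$, $\mathbb{O}_f(\mathbf{x})=\mathbb{O}_g(\mathbf{x})$. Smoother: an algorithm $\mathcal{S}$ is an $(L,\epsilon,T,M,r)$-smoother ($L,\epsilon,M,r>0$,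 $T\in\mathbb{N}$, $T\ge 1$) if for any $1$-Lipschitz function $f$ on $\mathbb{R}^d$ there exists a differentiable function $\tilde f$ on $\mathbb{R}^d$ such that: (1) $\|f-\tilde f\|_\infty\leq\epsilon$, and $\nabla\tilde f$ is $L$-Lipschitz. (2) Given any $\mathbf{x}\in\mathbb{R}^d$, the algorithm produces a (possibly randomized) query sequence $\{\mathbf{x}_1,\dots,\mathbf{x}_T\}\subset\{\mathbf{y}:\|\mathbf{y}-\mathbf{x}\|\leq r\}$ of the form $\mathbf{x}_{i+1}=\mathcal{S}^{(i)}(\xi,\mathbf{x},\mathbb{O}_f(\mathbf{x}_1),\dots,\mathbb{O}_f(\mathbf{x}_i))$, where $\mathcal{S}^{(i)}$ maps all the previous information gathered by the queries of some local oracle $\mathbb{O}_f$ to a new query, possibly based on a draw of some random variable $\xi$ (arbitrary randomness; the first query depends only on $\xi,\mathbf{x}$). Finally it produces a vector $\mathcal{S}(f,\mathbf{x}):=\mathcal{S}^{(out)}(\xi,\mathbf{x},\mathbb{O}_f(\mathbf{x}_1),\dots,\mathbb{O}_f(\mathbf{x}_T))$, where $\mathcal{S}^{(out)}$ is some mapping to $\mathbb{R}^d$, such that $\|\mathbb{E}_\xi[\mathcal{S}(f,\mathbf{x})]-\nabla\tilde f(\mathbf{x})\|\leq\epsilon$ and $\Pr_\xi[\|\mathcal{S}(f,\mathbf{x})\|\leq M]=1$. $\mathsf{TICF}$ (translation invariance w.r.t. constant functions): $\mathcal{S}$ satisfies $\mathsf{TICF}$ if for any two constant functions $f,g$, any $\mathbf{x}\in\mathbb{R}^d$,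 any query index $i$ (including the first query, which uses no oracle responses), and any realization of $\xi$, $\mathcal{S}^{(i)}(\xi,\mathbf{x},\mathbb{O}_f(\mathbf{x}_1),\dots,\mathbb{O}_f(\mathbf{x}_i))=\mathcal{S}^{(i)}(\xi,\mathbf{0},\mathbb{O}_g(\mathbf{x}_1-\mathbf{x}),\dots,\mathbb{O}_g(\mathbf{x}_i-\mathbf{x}))+\mathbf{x}$, and $\mathcal{S}^{(out)}(\xi,\mathbf{x},\mathbb{O}_f(\mathbf{x}_1),\dots,\mathbb{O}_f(\mathbf{x}_T))=\mathcal{S}^{(out)}(\xi,\mathbf{0},\mathbb{O}_g(\mathbf{x}_1-\mathbf{x}),\dots,\mathbb{O}_g(\mathbf{x}_T-\mathbf{x}))$, where $\mathbf{x}_1,\dots,\mathbf{x}_T$ are the queries. *)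

(* Defs.v *)
(* MathComp-Analysis. The notations of multinomials clash with it, hence the
   bare Require of mpoly. *)
From HB Require Import structures.
From mathcomp Require Import all_boot all_order all_algebra.
From mathcomp Require Import all_classical all_reals all_analysis.
From mathcomp Require mpoly.

Set Implicit Arguments.
Unset Strict Implicit.
Unset Printing Implicit Defensive.

Import Order.TTheory GRing.Theory Num.Theory.
Import numFieldNormedType.Exports.

Local Open Scope classical_set_scope.
Local Open Scope ring_scope.

Section Euclidean.
Context {R : realType} {d : nat}.
Implicit Types (f g : 'rV[R]_d -> R) (x y : 'rV[R]_d).

(* The norm `|x| of the library on 'rV[R]_d is the sup norm; it only serves
   here through its topology (nbhs, differentiable). *)
Definition enorm x : R := Num.sqrt (\sum_i x 0 i ^+ 2).

Definition elipschitz f : Prop := forall x y, `|f x - f y| <= enorm (x - y).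

Definition grad f x : 'rV[R]_d := \row_i 'D_(delta_mx 0 i) f x.

Definition grad_lipschitz (L : R) f : Prop :=
  forall x y, enorm (grad f x - grad f y) <= L * enorm (x - y).

Definition sup_dist f g : \bar R :=
  ereal_sup [set `|f x - g x|%:E | x in [set: 'rV[R]_d]].

End Euclidean.

Definition oracle (R : realType) (d : nat) (Ans : Type) :=
  ('rV[R]_d -> R) -> 'rV[R]_d -> Ans.

Definition local_oracle (R : realType) (d : nat) (Ans : Type)
    (O : oracle R d Ans) : Prop :=
  forall (f g : 'rV[R]_d -> R) (x : 'rV[R]_d),
    (\forall y \near x, f y = g y) -> O f x = O g x.

(* The map S^(i) is [query S] on sequences of i answers (i = 0 for the first
   query); [output S] is S^(out). The first argument is the realization of
   the randomness. *)
Record algorithm (R : realType) (d : nat) (Omega Ans : Type) := Algorithm {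
  query : Omega -> 'rV[R]_d -> seq Ans -> 'rV[R]_d ;
  output : Omega -> 'rV[R]_d -> seq Ans -> 'rV[R]_d }.

Section Run.
Context {R : realType} {d : nat} {Omega Ans : Type}.
Variables (O : oracle R d Ans) (S : algorithm R d Omega Ans).

Fixpoint queries (f : 'rV[R]_d -> R) (x : 'rV[R]_d) (xi : Omega) (i : nat)
    : seq 'rV[R]_d :=
  if i is j.+1 then
    let xs := queries f x xi j in
    rcons xs (query S xi x [seq O f y | y <- xs])
  else [::].

Definition run (T : nat) (f : 'rV[R]_d -> R) (x : 'rV[R]_d) (xi : Omega)
    : 'rV[R]_d :=
  output S xi x [seq O f y | y <- queries f x xi T].

(* Indices i < T are the T queries; a and b are the values of the two
   constant functions. *)
Definition TICF (T : nat) : Prop :=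
  forall (a b : R) (x : 'rV[R]_d) (xi : Omega),
    (forall i : nat, (i < T)%N ->
       let xs := queries (cst a) x xi i in
       query S xi x [seq O (cst a) y | y <- xs] =
       query S xi 0 [seq O (cst b) (y - x) | y <- xs] + x) /\
    (let xs := queries (cst a) x xi T in
     output S xi x [seq O (cst a) y | y <- xs] =
     output S xi 0 [seq O (cst b) (y - x) | y <- xs]).

End Run.

Section Smoother.
Context {R : realType} {d : nat} {disp : measure_display}
  {Omega : measurableType disp} (P : probability Omega R) {Ans : Type}.

Definition random_vector (X : Omega -> 'rV[R]_d) : Prop :=
  forall i, measurable_fun [set: Omega] (fun xi => X xi 0 i).

(* [fine] is harmless on the random vectors below: they are measurable and
   almost surely bounded. *)
Definition expect_vec (X : Omega -> 'rV[R]_d) : 'rV[R]_d :=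
  \row_i fine (expectation P (fun xi => X xi 0 i)).

(* Measurability of the output is what gives a meaning to its expectation and
   to the probability below; none is required of the queries. *)
Definition smoother (O : oracle R d Ans) (S : algorithm R d Omega Ans)
    (L eps : R) (T : nat) (M r : R) : Prop :=
  [/\ [/\ 0 < L, 0 < eps, (1 <= T)%N, 0 < M & 0 < r],
      local_oracle O &
      forall f : 'rV[R]_d -> R, elipschitz f ->
      exists ft : 'rV[R]_d -> R,
        [/\ (forall x, differentiable ft x),
            (sup_dist f ft <= eps%:E)%E,
            grad_lipschitz L ft &
            forall x : 'rV[R]_d,
              [/\ (forall xi y, y \in queries O S f x xi T ->
                     enorm (y - x) <= r),
                  random_vector (run O S T f x),
                  enorm (expect_vec (run O S T f x) - grad ft x) <= eps &
                  P [set xi | enorm (run O S T f x xi) <= M] = 1%E]]].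

End Smoother.

Definition polyval3 (R : realType) (p : mpoly.mpoly 3 R) (x y z : R) : R :=
  mpoly.meval (tnth [tuple x; y; z]) p.

(* Main.v *)
Require Import Defs.
From HB Require Import structures.
From mathcomp Require Import all_boot all_order all_algebra.
From mathcomp Require Import all_classical all_reals all_analysis.
From mathcomp Require Import measurable_realfun ring lra.
From mathcomp Require mpoly.
Import Order.TTheory GRing.Theory Num.Theory.
Import numFieldNormedType.Exports.
Local Open Scope ring_scope.

Set Implicit Arguments.
Unset Strict Implicit.
Unset Printing Implicit Defensive.

(** The hard instances are ridge functions [y |-> phi (w . y)] along a unit
    vector [w], where [phi] is a staircase: flat stretches of length [2 tau]
    alternate with rises of height [2 tau] and slope 1, so that [phi] grows at
    average rate 1/2.

    Queries issued from the middle [x] of a plateau stay on that plateau as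
    long as their displacements [z] satisfy [|w . z| < tau].  A local oracle
    then answers as for a constant function, and by translation invariance the
    output is the vector [Y] produced at the origin for the zero function
    ([run_plateau]).  The displacements of that reference run do not depend on
    [w] and have norm at most [r]; hence for [w] uniform among the sign vectors
    divided by [sqrt d], each of them reaches [|w . z| >= tau] only with
    probability [O(exp (- tau sqrt d / (2 r)))] ([signs_concentration]).

    The smooth approximation must follow the growth of the ridge up to an
    additive [2 eps], so over many plateaus its derivative along [w] has average
    at least about 1/2.  At the middle of a plateau this derivative is, up to
    [eps], the mean of the output against [w], and elsewhere it differs by at
    most [4 L tau] ([smoother_growth]).  Averaged over all [w], the outputs
    contribute at most [2 M delta], where [delta] is the fraction of directions
    that some query detects, because the sum of [Y . w] over all sign vectors
    vanishes ([average_output_le]).  This gives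
    [1/4 <= 2 M delta + 4 L tau] ([smoothing_tradeoff]).

    With [tau = 2 r] nothing is detected, whence [1 <= 32 L r].  With
    [tau = 2 r ln Q / sqrt d] and [Q >= 64 M T] the first term is at most 1/8,
    whence [sqrt d <= 64 L r ln Q].  For [r = O(eps)] and [M], [T] polynomial,
    [ln Q] is logarithmic in [d], [L] and [1 / eps].  The first bound controls
    [1 / eps] by [L], and a logarithm of [sqrt d / (eps L)] is absorbed in the
    left-hand side ([growth_rate]). *)

(** * Euclidean geometry *)

Definition dot (R : realType) (d : nat) (x y : 'rV[R]_d) : R :=
  \sum_i x 0 i * y 0 i.

Section Dot.
Context {R : realType} {d : nat}.
Implicit Types (x y w : 'rV[R]_d) (a : R).

Lemma dotC x y : dot x y = dot y x.
Proof. by apply: eq_bigr => i _; rewrite mulrC. Qed.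

Lemma dotDr x y z : dot x (y + z) = dot x y + dot x z.
Proof. by rewrite -big_split; apply: eq_bigr => i _; rewrite mxE mulrDr. Qed.

Lemma dotZr x a y : dot x (a *: y) = a * dot x y.
Proof. by rewrite mulr_sumr; apply: eq_bigr => i _; rewrite mxE mulrCA. Qed.

Lemma dotZl a x y : dot (a *: x) y = a * dot x y.
Proof. by rewrite dotC dotZr dotC. Qed.

Lemma dotBr x y z : dot x (y - z) = dot x y - dot x z.
Proof. by rewrite dotDr -scaleN1r dotZr mulN1r. Qed.

Lemma dotBl x y z : dot (x - y) z = dot x z - dot y z.
Proof. by rewrite dotC dotBr !(dotC z). Qed.

Lemma enorm_ge0 x : 0 <= enorm x.
Proof. exact: sqrtr_ge0. Qed.

Lemma sqr_enorm x : enorm x ^+ 2 = dot x x.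
Proof.
rewrite sqr_sqrtr; last by apply: sumr_ge0 => i _; exact: sqr_ge0.
by apply: eq_bigr => i _; rewrite expr2.
Qed.

Lemma enormZ a x : enorm (a *: x) = `|a| * enorm x.
Proof.
apply: (@pexpIrn _ 2) => //; rewrite ?nnegrE ?mulr_ge0 ?enorm_ge0//.
rewrite exprMn !sqr_enorm dotZr dotC dotZr mulrA -expr2.
by rewrite real_normK// num_real.
Qed.

(** Cauchy-Schwarz against a unit vector [w]: [x - (w.x) w] is orthogonal to
    [w], so its square norm is [|x|^2 - (w.x)^2]. *)
Lemma abs_dot_le w x : dot w w = 1 -> `|dot w x| <= enorm x.
Proof.
move=> w1; rewrite -ler_sqr ?nnegrE ?enorm_ge0// real_normK ?num_real//.
rewrite -subr_ge0 (_ : _ - _ = enorm (x - dot w x *: w) ^+ 2) ?sqr_ge0//.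
by rewrite !sqr_enorm dotBr !dotBl !dotZr !dotZl w1 (dotC x); ring.
Qed.

Lemma coord_le_enorm x i : `|x 0 i| <= enorm x.
Proof.
rewrite -ler_sqr ?nnegrE ?enorm_ge0// real_normK ?num_real// sqr_enorm.
rewrite /dot (bigD1 i)//= -expr2 lerDl; apply: sumr_ge0 => j _.
by rewrite -expr2 sqr_ge0.
Qed.

End Dot.

(** * Staircase functions *)

(** The member of index [j] rises with slope 1 and is capped at the height of
    the plateau number [j], which is centred at [4 tau j].  Near that centre
    the members of smaller index are capped lower, and those of larger index
    have not risen above it yet.  A maximum of minima of 1-Lipschitz functions
    is 1-Lipschitz at once, which a definition by cases would not show. *)
Definition stair (R : realType) (tau : R) (K : nat) (t : R) : R :=
  \big[Num.max/0]_(j < K.+1)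
    Num.min (2 * tau * j%:R) (t - 2 * tau * j%:R + tau).

Section Stair.
Context {R : realType}.
Implicit Types (tau t u : R) (K k : nat).

Lemma stair_le_add tau K t u :
  stair tau K t <= stair tau K u + `|t - u|.
Proof.
have tu : t - u <= `|t - u| := ler_norm _.
apply: bigmax_le => [|j _].
  by rewrite addr_ge0//; apply: bigmax_ge_id.
apply: (@le_trans _ _ (Num.min (2 * tau * j%:R) (u - 2 * tau * j%:R + tau)
                       + `|t - u|)).
  by rewrite addr_minl le_min !ge_min lerDl normr_ge0/=; apply/orP; right; lra.
rewrite lerD2r.
exact: (@le_bigmax _ _ _ 0 (fun j : 'I_K.+1 =>
  Num.min (2 * tau * j%:R) (u - 2 * tau * j%:R + tau)) j).
Qed.

Lemma stair_lipschitz tau K t u :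
  `|stair tau K t - stair tau K u| <= `|t - u|.
Proof.
rewrite ler_norml; apply/andP; split.
  by rewrite lerNl opprB lerBlDl distrC stair_le_add.
by rewrite lerBlDl stair_le_add.
Qed.

Lemma stair_plateau tau K k t : 0 < tau -> (k <= K)%N ->
  `|t - 4 * tau * k%:R| <= tau -> stair tau K t = 2 * tau * k%:R.
Proof.
move=> tau0 kK; rewrite ler_norml => /andP[lo hi].
apply/eqP; rewrite eq_le; apply/andP; split.
  apply: bigmax_le => [|j _]; first by rewrite !mulr_ge0// ltW.
  have [jk|kj] := leqP j k.
    by rewrite ge_min ler_pM2l ?ler_nat ?jk// mulr_gt0.
  have {kj} : k.+1%:R <= j%:R :> R by rewrite ler_nat.
  rewrite -natr1 => kj; rewrite ge_min; apply/orP; right.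
  by have := ler_wpM2l (ltW tau0) kj; lra.
rewrite -[leLHS](_ : Num.min (2 * tau * k%:R) (t - 2 * tau * k%:R + tau) = _).
  have kK1 : (k < K.+1)%N by [].
  exact: (@le_bigmax _ _ _ 0 (fun j : 'I_K.+1 =>
    Num.min (2 * tau * j%:R) (t - 2 * tau * j%:R + tau)) (Ordinal kK1)).
by apply/min_idPl; lra.
Qed.

End Stair.

(** * Growth of a smooth function along a line *)

Section Gradient.
Context {R : realType} {d : nat}.
Implicit Types (f : 'rV[R]_d -> R) (x w : 'rV[R]_d).

Lemma derive_grad f x w : differentiable f x -> 'D_w f x = dot (grad f x) w.
Proof.
move=> df; rewrite deriveE// {1}[w]row_sum_delta linear_sum.
apply: eq_bigr => i _.
by rewrite linearZ /= -deriveE// mxE mulrC.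
Qed.

Lemma is_derive_line f x w (t : R) : differentiable f (x + t *: w) ->
  is_derive t 1 (fun u : R => f (x + u *: w)) (dot (grad f (x + t *: w)) w).
Proof.
move=> df; rewrite -derive_grad//.
have E : (fun h : R =>
      h^-1 *: (f (x + (h *: (1 : R) + t) *: w) - f (x + t *: w)))
  = (fun h : R => h^-1 *: (f (h *: w + (x + t *: w)) - f (x + t *: w))).
  apply: funext => h; congr (_ *: (f _ - _)).
  by rewrite [h *: 1]mulr1 scalerDl addrCA.
apply: DeriveDef; last by rewrite /derive /= E.
have := @diff_derivable R _ _ f _ w df.
by rewrite /derivable /= E.
Qed.

(** The gradient moves by at most [L h] along the segment, and the mean value
    theorem turns its value into the increment of [f]. *)
Lemma increment_le f (L h : R) x w : (forall y, differentiable f y) ->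
  grad_lipschitz L f -> dot w w = 1 -> 0 <= L -> 0 < h ->
  f (x + h *: w) - f x <= h * (dot w (grad f x) + L * h).
Proof.
move=> df lf w1 L0 h0.
have dl (t : R) : is_derive t (1 : R) (fun u : R => f (x + u *: w))
    (dot (grad f (x + t *: w)) w) by exact: is_derive_line.
have cl :
    ({within `[0, h], continuous (fun u : R => f (x + u *: w)%R)})%classic.
  apply: continuous_subspaceT => t; apply: differentiable_continuous.
  by apply/derivable1_diffP; exact: ex_derive.
have [c] := @MVT R _ _ 0 h h0 (fun t _ => dl t) cl.
rewrite in_itv/= => /andP[c0 ch]; rewrite scale0r addr0 subr0 => ->.
rewrite mulrC ler_pM2l// -lerBlDl (dotC w) -dotBl dotC.
apply: (le_trans (ler_norm _)); apply: (le_trans (abs_dot_le _ w1)).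
apply: (le_trans (lf _ _)); rewrite ler_wpM2l//.
have -> : x + c *: w - x = c *: w by rewrite addrC addKr.
rewrite enormZ (_ : enorm w = 1) ?mulr1 ?gtr0_norm ?(ltW ch)//.
apply: (@pexpIrn _ 2) => //; rewrite ?nnegrE ?enorm_ge0//.
by rewrite sqr_enorm w1 expr1n.
Qed.

End Gradient.

(** * Random signs *)

Definition signvec (R : realType) (d : nat) (s : {ffun 'I_d -> bool}) :
    'rV[R]_d :=
  \row_i ((-1) ^+ s i / Num.sqrt d%:R).

Section Signs.
Context {R : realType} {d : nat}.
Implicit Types (s : {ffun 'I_d -> bool}) (z v : 'rV[R]_d).

Lemma signvec_unit s : (0 < d)%N -> dot (signvec R s) (signvec R s) = 1.
Proof.
move=> d0; rewrite /dot; under eq_bigr => i _.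
  rewrite mxE -expr2 exprMn sqrr_sign mul1r exprVn sqr_sqrtr ?ler0n//.
  over.
by rewrite sumr_const card_ord -[LHS]mulr_natr mulVf// pnatr_eq0 -lt0n.
Qed.

Definition flip s : {ffun 'I_d -> bool} := [ffun i => ~~ s i].

Lemma sum_flip (f : {ffun 'I_d -> bool} -> R) :
  \sum_s f (flip s) = \sum_s f s.
Proof.
rewrite [RHS](reindex_inj (h := flip))//.
by apply: (can_inj (g := flip)) => s; apply/ffunP => i; rewrite !ffunE negbK.
Qed.

Lemma signvecN s : signvec R (flip s) = - signvec R s.
Proof. by apply/rowP => i; rewrite !mxE ffunE signrN mulNr. Qed.

Lemma sum_signvec_dot v : \sum_s dot (signvec R s) v = 0.
Proof.
have E : \sum_s dot (signvec R s) v = - \sum_s dot (signvec R s) v.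
  rewrite -{1}sum_flip -sumrN; apply: eq_bigr => s _.
  by rewrite signvecN -scaleN1r dotZl mulN1r.
by lra.
Qed.

(** A weak form of [cosh a <= exp (a^2 / 2)] that follows from [1 + x <= expR x]
    alone. *)
Lemma expR_add_expRN_le (a : R) : `|a| <= 2^-1 ->
  expR a + expR (- a) <= 2 * expR (2 * a ^+ 2).
Proof.
(* [expR b <= 1 / (1 - b)], and
   [(1 - b) (1 + b + 2 b^2) >= 1] when [b <= 1/2]. *)
have half b : b <= 2^-1 -> expR b <= 1 + b + 2 * b ^+ 2 :> R.
  move=> b2; have := @expR_ge1Dx R (- b); rewrite expRN.
  have e0 := expR_gt0 b.
  rewrite -(ler_pM2r e0) mulVf ?gt_eqF// => h.
  have b1 : 0 < 1 - b by lra.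
  rewrite -(ler_pM2l b1); apply: (le_trans h).
  have : 0 <= b ^+ 2 * (1 - 2 * b) by rewrite mulr_ge0 ?sqr_ge0//; lra.
  by lra.
rewrite ler_norml => /andP[lo hi].
have h1 := half a hi; have /half : - a <= 2^-1 by lra.
rewrite sqrrN => h2; have := @expR_ge1Dx R (2 * a ^+ 2); lra.
Qed.

(** The signs are independent: the sum over all sign patterns factors into
    one sum of two terms per coordinate. *)
Lemma sum_expR_signs z : (forall i, `|z 0 i| <= 2^-1) ->
  \sum_(s : {ffun 'I_d -> bool}) expR (\sum_i (-1) ^+ s i * z 0 i)
  <= 2 ^+ d * expR (2 * dot z z).
Proof.
move=> z2.
have -> : \sum_(s : {ffun 'I_d -> bool}) expR (\sum_i (-1) ^+ s i * z 0 i)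
    = \prod_(i < d) \sum_(b : bool) expR ((-1) ^+ b * z 0 i).
  rewrite bigA_distr_bigA /=; apply: eq_bigr => s _; exact: expR_sum.
have -> : 2 ^+ d * expR (2 * dot z z)
    = \prod_(i < d) (2 * expR (2 * z 0 i ^+ 2)).
  rewrite big_split /= prodr_const card_ord; congr (_ * _).
  by rewrite /dot mulr_sumr expR_sum; apply: eq_bigr.
apply: ler_prod => i _; rewrite big_bool /= expr1 expr0 mulN1r mul1r addrC.
by rewrite addr_ge0 ?expR_ge0//= expR_add_expRN_le.
Qed.

(** Exponential Markov inequality with parameter [sqrt d / (2 r)], the largest
    multiple of [sqrt d / r] for which every coordinate stays in the range
    [|a| <= 1/2] of [expR_add_expRN_le].  The resulting tail is exponential
    rather than Gaussian, at the cost of a power of a logarithm in the final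
    rate. *)
Lemma signs_concentration (r tau : R) z : (0 < d)%N -> 0 < r -> enorm z <= r ->
  \sum_(s : {ffun 'I_d -> bool}) (tau <= `|dot (signvec R s) z|)%R%:R
  <= 2 ^+ d * (4 * expR (- (tau * Num.sqrt d%:R / (2 * r)))).
Proof.
move=> d0 r0 zr.
have q0 : 0 < Num.sqrt d%:R :> R by rewrite sqrtr_gt0 ltr0n.
pose l : R := Num.sqrt d%:R / (2 * r).
have l0 : 0 < l by rewrite divr_gt0// mulr_gt0.
pose y := (2 * r)^-1 *: z.
have r20 : 0 < 2 * r by rewrite mulr_gt0.
have dy s : l * dot (signvec R s) z = \sum_i (-1) ^+ s i * y 0 i.
  rewrite mulr_sumr; apply: eq_bigr => i _; rewrite !mxE /l.
  by field; rewrite !gt_eqF.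
have ey : enorm y <= 2^-1.
  rewrite enormZ gtr0_norm ?invr_gt0// ler_pdivrMl//.
  by apply: (le_trans zr); lra.
have y2 i : `|y 0 i| <= 2^-1 := le_trans (coord_le_enorm y i) ey.
(* The exponent is at most [2 * (1/2)^2] and [expR (1/2) <= 2]. *)
have H : \sum_(s : {ffun 'I_d -> bool}) expR (l * dot (signvec R s) z)
    <= 2 ^+ d * 2.
  under eq_bigr do rewrite dy.
  apply: (le_trans (sum_expR_signs y2)); rewrite ler_wpM2l ?exprn_ge0//.
  rewrite -sqr_enorm.
  have : enorm y ^+ 2 <= 2^-1 ^+ 2 by rewrite ler_sqr ?nnegrE ?enorm_ge0.
  move=> e2; have e1 : expR (2 * enorm y ^+ 2) <= expR 2^-1.
    by rewrite ler_expR; lra.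
  apply: (le_trans e1); have := @expR_ge1Dx R (- 2^-1).
  rewrite expRN -(ler_pM2r (expR_gt0 2^-1)) mulVf ?gt_eqF ?expR_gt0//; lra.
have HN : \sum_(s : {ffun 'I_d -> bool}) expR (- (l * dot (signvec R s) z))
    <= 2 ^+ d * 2.
  rewrite -sum_flip; apply: le_trans H; apply: ler_sum => s _.
  by rewrite signvecN -[- signvec R s]scaleN1r dotZl mulN1r mulrN opprK.
rewrite (_ : _ / _ = l * tau); last by rewrite /l; ring.
have key s : (tau <= `|dot (signvec R s) z|)%R%:R <= expR (- (l * tau)) *
    (expR (l * dot (signvec R s) z) + expR (- (l * dot (signvec R s) z))).
  case: (leP tau _) => h /=; last by rewrite mulr_ge0 ?addr_ge0 ?expR_ge0.
  rewrite mulrDr -!expRD.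
  have [/ltW s0|s0] := ltP (dot (signvec R s) z) 0;
    rewrite ?(ler0_norm s0) ?(ger0_norm s0) in h.
    rewrite -[leLHS]add0r lerD ?expR_ge0// -expR0 ler_expR -opprD oppr_ge0.
    by rewrite -mulrDr mulr_ge0_le0 ?(ltW l0)//; lra.
  rewrite -[leLHS]addr0 lerD ?expR_ge0// -expR0 ler_expR addrC -mulrBr.
  by rewrite mulr_ge0 ?(ltW l0)// subr_ge0.
apply: (le_trans (ler_sum _ (fun s _ => key s))).
rewrite -mulr_sumr big_split /=.
rewrite (_ : 2 ^+ d * _ = expR (- (l * tau)) * (2 ^+ d * 2 + 2 ^+ d * 2));
  last by ring.
by rewrite ler_wpM2l ?expR_ge0// lerD.
Qed.

Definition detected (tau : R) (zs : seq 'rV[R]_d) s : bool :=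
  has (fun z => tau <= `|dot (signvec R s) z|) zs.

Lemma detected_rare (r tau : R) (zs : seq 'rV[R]_d) : (0 < d)%N -> 0 < r ->
  (forall z, z \in zs -> enorm z <= r) ->
  \sum_s (detected tau zs s)%:R <= 2 ^+ d *
    ((size zs)%:R * (4 * expR (- (tau * Num.sqrt d%:R / (2 * r))))).
Proof.
move=> d0 r0; elim: zs => [|z zs IH] zr.
  by rewrite big1 ?mul0r ?mulr0.
have {}IH := IH (fun y yz => zr y (mem_behead (s := z :: zs) yz)).
have zr1 := zr z (mem_head z zs).
apply: (@le_trans _ _ (\sum_s ((tau <= `|dot (signvec R s) z|)%R%:R
                               + (detected tau zs s)%:R))).
  apply: ler_sum => s _; rewrite /detected /= -natrD ler_nat.
  by case: (tau <= _)%R; case: (has _ _).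
rewrite big_split /= -natr1; have := signs_concentration tau d0 r0 zr1; lra.
Qed.

End Signs.

(** * Runs that only see a locally constant function *)

Section Runs.
Context {R : realType} {d : nat} {Omega Ans : Type}.
Variables (O : oracle R d Ans) (S : algorithm R d Omega Ans).

Lemma queries_eq_const (f : 'rV[R]_d -> R) a x xi n : local_oracle O ->
  (forall y, y \in queries O S (cst a) x xi n -> \forall u \near y, f u = a) ->
  queries O S f x xi n = queries O S (cst a) x xi n.
Proof.
move=> lO; elim: n => // n IH fa /=.
have fa' y : y \in queries O S (cst a) x xi n -> \forall u \near y, f u = a.
  by move=> yn; apply: fa; rewrite /= mem_rcons inE yn orbT.
rewrite (IH fa'); congr (rcons _ (query S _ _ _)).
by apply/eq_in_map => y /fa' fy; apply: lO.
Qed.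

(** Induction on the number of queries: if the first [n] queries at [x] are the
    translates of those at the origin, translation invariance applied to the
    same answers gives the next one. *)
Lemma queries_const T a x xi n : TICF O S T -> (n <= T)%N ->
  queries O S (cst a) x xi n = [seq z + x | z <- queries O S (cst 0) 0 xi n].
Proof.
move=> tS; elim: n => // n IH nT /=.
rewrite map_rcons IH ?(ltnW nT)//; congr rcons.
have /= := (tS a 0 x xi).1 n nT; rewrite IH ?(ltnW nT)// => ->.
rewrite -map_comp; congr (query _ _ _ _ + _).
by apply: eq_map => z /=; rewrite addrK.
Qed.

(** The displacements [z] are those of the reference run at the origin, so the
    same sequence of displacements serves every function [f], point [x] and
    plateau value [a]. *)
Lemma run_plateau (f : 'rV[R]_d -> R) T a x xi : local_oracle O -> TICF O S T ->
  (forall z, z \in queries O S (cst 0) 0 xi T ->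
     \forall u \near z + x, f u = a) ->
  run O S T f x xi = run O S T (cst 0) 0 xi.
Proof.
move=> lO tS fa.
have fa' y : y \in queries O S (cst a) x xi T -> \forall u \near y, f u = a.
  by rewrite (queries_const _ _ _ tS)// => /mapP[z zT ->]; exact: fa.
rewrite /run (queries_eq_const lO fa').
have -> : [seq O f y | y <- queries O S (cst a) x xi T]
        = [seq O (cst a) y | y <- queries O S (cst a) x xi T].
  by apply/eq_in_map => y /fa' fy; apply: lO.
have /= -> := (tS a 0 x xi).2; rewrite (queries_const _ _ _ tS)// -map_comp.
by congr (output _ _ _ _); apply: eq_map => z /=; rewrite addrK.
Qed.

End Runs.

Section Ridge.
Context {R : realType} {d : nat}.
Implicit Types (w x : 'rV[R]_d) (tau : R) (K k : nat).

Definition ridge tau K w (y : 'rV[R]_d) : R := stair tau K (dot w y).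

Lemma ridge_lipschitz tau K w : dot w w = 1 -> elipschitz (ridge tau K w).
Proof.
move=> w1 x y; apply: le_trans (stair_lipschitz _ _ _ _) _.
by rewrite -dotBr abs_dot_le.
Qed.

Lemma continuous_dot w : continuous (dot w).
Proof.
have cM i : continuous (fun y : 'rV[R]_d => w 0 i * y 0 i).
  move=> y; apply: continuousM; last exact: coord_continuous.
  exact: cst_continuous.
have cD : continuous (fun z : R * R => z.1 + z.2) by exact: (@add_continuous R).
exact: (@continuous_big R 'I_d +%R 0 xpredT cD _ _
  (fun i (y : 'rV[R]_d) => w 0 i * y 0 i) (fun i _ => cM i)).
Qed.

Lemma ridge_near tau K w k z : 0 < tau -> dot w w = 1 -> (k <= K)%N ->
  `|dot w z| < tau ->
  \forall u \near z + (4 * tau * k%:R) *: w, ridge tau K w u = 2 * tau * k%:R.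
Proof.
move=> t0 w1 kK zt.
have e0 : 0 < tau - `|dot w z| by rewrite subr_gt0.
have := @continuous_dot w (z + (4 * tau * k%:R) *: w).
move=> /cvgrPdist_lt /(_ _ e0); apply: filterS => u.
rewrite dotDr dotZr w1 mulr1 => uz; rewrite /ridge; apply: stair_plateau => //.
move: uz; rewrite ltr_norml ler_norml => /andP[lo hi].
have := ler_norm (dot w z); have := ler_norm (- dot w z); rewrite normrN => ? ?.
by apply/andP; split; lra.
Qed.

End Ridge.

(** * Averages of almost surely bounded random vectors *)

Section Expectation.
Local Open Scope classical_set_scope.
Context {R : realType} {d : nat} {disp : measure_display}
  {Omega : measurableType disp} (P : probability Omega R).

Lemma integrable_sum_EFin (D : set Omega) (I : Type) (r : seq I)
    (f : I -> Omega -> R) : measurable D ->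
  (forall i, P.-integrable D (EFin \o f i)) ->
  P.-integrable D (EFin \o (fun x => \sum_(i <- r) f i x)).
Proof.
move=> mD fi; rewrite (_ : _ \o _ = fun x => (\sum_(i <- r) (EFin \o f i) x)%E).
  exact: integrable_sum.
by apply: funext => x /=; rewrite sumEFin.
Qed.

Lemma Rintegral_sum (D : set Omega) (I : Type) (r : seq I)
    (f : I -> Omega -> R) : measurable D ->
  (forall i, P.-integrable D (EFin \o f i)) ->
  (\int[P]_(x in D) \sum_(i <- r) f i x
    = \sum_(i <- r) \int[P]_(x in D) f i x)%R.
Proof.
move=> mD fi; elim: r => [|i r IH].
  under eq_Rintegral do rewrite big_nil.
  by rewrite Rintegral_cst// mul0r big_nil.
under eq_Rintegral do rewrite big_cons.
by rewrite RintegralD//; [rewrite big_cons IH | exact: integrable_sum_EFin].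
Qed.

Lemma measurable_enorm_le (X : Omega -> 'rV[R]_d) (M : R) :
  random_vector X -> measurable [set xi | enorm (X xi) <= M].
Proof.
move=> mX.
have m2 : measurable_fun [set: Omega] (fun xi => enorm (X xi)).
  apply: measurableT_comp.
    exact: (continuous_measurable_fun (@sqrt_continuous R)).
  by apply: measurable_sum => i; exact: measurable_funX.
have := m2 measurableT _ (measurable_itv `]-oo, M]%R).
by rewrite setTI; congr measurable.
Qed.

(** A bound on a finite sum of projections that holds for every realization
    passes to the expectations.  The family is summed before integrating
    because the realizations that detect one given direction need not form a
    measurable set: only the outputs can be integrated, not the probability of
    detection. *)
Lemma sum_dot_expect_le (I : finType) (w : I -> 'rV[R]_d)
    (X : I -> Omega -> 'rV[R]_d) (M B : R) :
  (forall s, random_vector (X s)) ->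
  (forall s, P [set xi | enorm (X s xi) <= M] = 1%E) ->
  (forall xi, (forall s, enorm (X s xi) <= M) ->
     \sum_s dot (w s) (X s xi) <= B) ->
  \sum_s dot (w s) (expect_vec P (X s)) <= B.
Proof.
move=> mX XM XB.
pose A := \big[setI/setT]_s [set xi | enorm (X s xi) <= M].
have mA : measurable A.
  by apply: bigsetI_measurable => s _; exact: measurable_enorm_le.
have AM xi s : A xi -> enorm (X s xi) <= M.
  by rewrite /A -bigcap_seq => /(_ s); apply; rewrite /= mem_index_enum.
have PA0 : P (~` A) = 0%E.
  apply/(negligibleP P (measurableC mA)); rewrite /A setC_bigsetI.
  elim/big_ind : _ => [||s _]; [exact: negligible_set0 | exact: negligibleU |].
  have mXs := measurable_enorm_le M (mX s).
  apply/(negligibleP P (measurableC mXs)).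
  by have := probability_setC P mXs; rewrite XM subee.
have PA : P A = 1%E.
  by rewrite -[A]setCK probability_setC ?PA0 ?sube0//; exact: measurableC.
have iX s i : P.-integrable A (EFin \o (fun xi => X s xi 0 i)).
  apply: measurable_bounded_integrable => //.
  - exact: le_lt_trans (probability_le1 P mA) (ltry 1).
  - exact: measurable_funTS (mX s i).
  exists M; split; first exact: num_real.
  move=> N MN xi Axi; apply: le_trans (ltW MN).
  exact: le_trans (coord_le_enorm _ _) (AM _ _ Axi).
have EX s i : expect_vec P (X s) 0 i = (\int[P]_(xi in A) X s xi 0 i)%R.
  rewrite mxE unlock /Rintegral; congr fine.
  rewrite [RHS]integral_mkcond; apply: ae_eq_integral => //.
  - by apply/measurable_EFinP; exact: mX.
  - apply/(measurable_restrictT _ mA)/measurable_EFinP.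
    exact: measurable_funTS (mX s i).
  exists (~` A); split => //; first exact: measurableC.
  move=> xi /= nE Axi; apply: nE => _; rewrite patchE mem_set//.
have iM s i : P.-integrable A (EFin \o (fun xi => w s 0 i * X s xi 0 i)).
  pose c := w s 0 i; pose g xi := X s xi 0 i.
  rewrite (_ : _ \o _ = fun xi => (c%:E * (EFin \o g) xi)%E).
    by apply: integrableZl => //; exact: iX.
  by apply: funext => xi; rewrite /= EFinM.
have iD s : P.-integrable A (EFin \o (fun xi => dot (w s) (X s xi))).
  exact: integrable_sum_EFin.
have -> : \sum_s dot (w s) (expect_vec P (X s))
    = (\int[P]_(xi in A) \sum_s dot (w s) (X s xi))%R.
  rewrite Rintegral_sum//; apply: eq_bigr => s _; rewrite Rintegral_sum//.
  by apply: eq_bigr => i _; rewrite EX RintegralZl.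
rewrite (_ : B = \int[P]_(xi in A) B)%R; last first.
  by rewrite Rintegral_cst// (_ : fine _ = 1) ?mulr1//; exact: (congr1 fine PA).
apply: le_Rintegral => //.
- exact: integrable_sum_EFin.
- exact: finite_measure_integrable_cst.
- by move=> xi Axi; apply: XB => s; exact: AM.
Qed.

End Expectation.

(** * The trade-off between smoothness and query radius *)

Section Tradeoff.
Context {R : realType} {d : nat} {disp : measure_display}
  {Omega : measurableType disp} (P : probability Omega R) {Ans : Type}.
Variables (O : oracle R d Ans) (S : algorithm R d Omega Ans).
Variables (L eps : R) (T : nat) (M r : R).
Hypothesis smS : smoother P O S L eps T M r.

(** From the middle of one plateau to the middle of the next one the smooth
    approximation grows by at most [4 tau] times its slope at the start plus
    [4 L tau]; the sum over [K] plateaus telescopes and has to account for the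
    whole height of the staircase. *)
Lemma smoother_growth (w : 'rV[R]_d) (tau : R) (K : nat) :
  0 < tau -> dot w w = 1 ->
  2 * tau * K%:R - 2 * eps <= 4 * tau * \sum_(k < K)
    (dot w (expect_vec P (run O S T (ridge tau K w) ((4 * tau * k%:R) *: w)))
     + eps + 4 * L * tau).
Proof.
move=> t0 w1; have [[L0 e0 _ _ _] _ sS] := smS.
have [ft [dft supft lft Hx]] := sS _ (ridge_lipschitz tau K w1).
have close x : `|ridge tau K w x - ft x| <= eps.
  rewrite -lee_fin; apply: le_trans supft; apply: ereal_sup_ubound.
  by exists x.
have ridgeE (k : nat) : (k <= K)%N ->
    ridge tau K w ((4 * tau * k%:R) *: w) = 2 * tau * k%:R.
  move=> kK; apply: stair_plateau => //.
  by rewrite dotZr w1 mulr1 subrr normr0 ltW.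
pose u k := ft ((4 * tau * k%:R) *: w).
have step (k : nat) : u k.+1 - u k <= 4 * tau *
    (dot w (expect_vec P (run O S T (ridge tau K w) ((4 * tau * k%:R) *: w)))
     + eps + 4 * L * tau).
  set x := (4 * tau * k%:R) *: w.
  have -> : u k.+1 = ft (x + (4 * tau) *: w).
    by rewrite /u /x -scalerDl -natr1; congr (ft (_ *: _)); ring.
  have t40 : 0 < 4 * tau by rewrite mulr_gt0.
  apply: le_trans (increment_le x dft lft w1 (ltW L0) t40) _.
  rewrite ler_pM2l//.
  have [_ _ gx _] := Hx x.
  have := le_trans (ler_norm _) (le_trans (abs_dot_le
    (grad ft x - expect_vec P (run O S T (ridge tau K w) x)) w1) _).
  move=> /(_ eps); rewrite dotBr => h.
  have {}h : dot w (grad ft x)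
      - dot w (expect_vec P (run O S T (ridge tau K w) x)) <= eps.
    apply: h; apply: le_trans gx.
    by rewrite -opprB -scaleN1r enormZ normrN1 mul1r.
  by lra.
have := ler_sum (index_enum 'I_K) (fun k (_ : xpredT k) => step (val k)).
rewrite -mulr_sumr -(big_mkord xpredT (fun k => u k.+1 - u k)) telescope_sumr//.
apply: le_trans.
have := close ((4 * tau * K%:R) *: w); have := close ((4 * tau * 0%:R) *: w).
rewrite !ridgeE// -/(u K) -/(u 0%N) mulr0 !ler_norml => /andP[_ h1] /andP[_ h2].
have := close ((4 * tau * 0%:R) *: w); rewrite ridgeE// -/(u 0%N) mulr0.
by rewrite ler_norml => /andP[h3 _]; lra.
Qed.

Hypothesis tS : TICF O S T.

Variables (tau delta : R).
Hypotheses (d0 : (0 < d)%N) (t0 : 0 < tau).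

Hypothesis rare : forall zs : seq 'rV[R]_d, size zs = T ->
  (forall z, z \in zs -> enorm z <= r) ->
  \sum_s (detected tau zs s)%:R <= 2 ^+ d * delta.

Lemma size_queries f x xi n : size (queries O S f x xi n) = n.
Proof. by elim: n => //= n IH; rewrite size_rcons IH. Qed.

Lemma cst_lipschitz (a : R) : elipschitz (cst a : 'rV[R]_d -> R).
Proof. by move=> x y; rewrite subrr normr0 enorm_ge0. Qed.

(** An undetected direction [s] yields the output [Y] of the reference run.
    Subtracting [Y] from all outputs leaves the sum unchanged, since the sign
    vectors sum to zero, and kills the undetected terms; each of the others is
    at most [2 M]. *)
Lemma average_output_le (K k : nat) : (k <= K)%N ->
  \sum_s dot (signvec R s) (expect_vec P (run O S T
     (ridge tau K (signvec R s)) ((4 * tau * k%:R) *: signvec R s)))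
  <= 2 * M * (2 ^+ d * delta).
Proof.
move=> kK; have [[_ _ _ M0 _] lO sS] := smS.
have w1 s := signvec_unit (R := R) s d0.
apply: (@sum_dot_expect_le _ _ _ _ P _ (fun s => signvec R s) _ M).
- move=> s; have [ft [_ _ _ Hx]] := sS _ (ridge_lipschitz tau K (w1 s)).
  by have [_] := Hx ((4 * tau * k%:R) *: signvec R s).
- move=> s; have [ft [_ _ _ Hx]] := sS _ (ridge_lipschitz tau K (w1 s)).
  by have [_ _ _] := Hx ((4 * tau * k%:R) *: signvec R s).
move=> xi; pose X s := run O S T (ridge tau K (signvec R s))
  ((4 * tau * k%:R) *: signvec R s) xi.
rewrite -/(X _) => XM.
rewrite [leLHS](_ : _ = \sum_s dot (signvec R s) (X s))//.
pose Y := run O S T (cst 0) 0 xi.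
pose zs := queries O S (cst 0) 0 xi T.
have zr z : z \in zs -> enorm z <= r.
  have [ft [_ _ _ Hx]] := sS _ (cst_lipschitz 0).
  by have [+ _ _ _] := Hx 0 => /(_ xi z) /[apply]; rewrite subr0.
have good s : ~~ detected tau zs s -> X s = Y.
  move=> /hasPn nd; apply: run_plateau lO tS _ => z /nd; rewrite -ltNge => zt.
  exact: ridge_near.
have dotM s : `|dot (signvec R s) (X s)| <= M.
  exact: le_trans (abs_dot_le _ (w1 s)) (XM s).
apply: (@le_trans _ _ (2 * M * \sum_s (detected tau zs s)%:R)); last first.
  rewrite ler_wpM2l ?mulr_ge0 ?(ltW M0)//; apply: rare zr.
  exact: size_queries.
rewrite mulr_sumr.
(* The bound [enorm Y <= M] is inherited from an undetected direction; without
   one, the trivial bound [M] on every term suffices. *)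
case: (pickP (fun s => ~~ detected tau zs s)) => [s0 /good Xs0|all_bad];
  last first.
  apply: ler_sum => s _; have /negbFE -> := all_bad s.
  rewrite mulr1; apply: (le_trans (ler_norm _)).
  by apply: (le_trans (dotM s)); lra.
have YM : enorm Y <= M by rewrite -Xs0; exact: XM.
have -> : \sum_s dot (signvec R s) (X s)
    = \sum_s (dot (signvec R s) (X s) - dot (signvec R s) Y).
  by rewrite sumrB sum_signvec_dot subr0.
apply: ler_sum => s _.
case: (boolP (detected tau zs s)) => [_|/good ->]; last by rewrite subrr mulr0.
have := le_trans (abs_dot_le Y (w1 s)) YM; have := dotM s.
by rewrite !ler_norml => /andP[? ?] /andP[? ?]; rewrite mulr1; lra.
Qed.

(** [K] is taken so large that the error [2 eps] at both ends is negligible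
    against the height [2 tau K] of the staircase. *)
Lemma smoothing_tradeoff : eps <= 8^-1 -> 4^-1 <= 2 * M * delta + 4 * L * tau.
Proof.
move=> e8; have [[L0 e0 _ M0 _] _ _] := smS.
have [K Kbig] : exists K : nat, eps / tau * 4 < K%:R.
  exists (Num.bound (eps / tau * 4)); apply: archi_boundP.
  by rewrite mulr_ge0// divr_ge0 ?ltW.
have {}Kbig : 4 * eps < tau * K%:R.
  by move: Kbig; rewrite mulrAC ltr_pdivrMr// mulrC (mulrC tau).
have K0 : 0 < tau * K%:R by apply: lt_trans Kbig; rewrite mulr_gt0.
have w1 s := signvec_unit (R := R) s d0.
pose E s (k : nat) := expect_vec P (run O S T (ridge tau K (signvec R s))
  ((4 * tau * k%:R) *: signvec R s)).
have card2 (c : R) : \sum_(s : {ffun 'I_d -> bool}) c = 2 ^+ d * c.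
  by rewrite sumr_const card_ffun card_bool card_ord -[LHS]mulr_natl natrX.
have growth : \sum_(s : {ffun 'I_d -> bool}) (2 * tau * K%:R - 2 * eps)
    <= \sum_s 4 * tau * \sum_(k < K)
      (dot (signvec R s) (E s k) + eps + 4 * L * tau).
  by apply: ler_sum => s _; exact: (smoother_growth K t0 (w1 s)).
have average (k : 'I_K) :
    \sum_s (dot (signvec R s) (E s k) + eps + 4 * L * tau)
    <= 2 ^+ d * (2 * M * delta + eps + 4 * L * tau).
  rewrite big_split big_split /= !card2.
  have := average_output_le (ltnW (ltn_ord k)).
  by rewrite -/(E _ k); lra.
move: growth; rewrite card2 -mulr_sumr exchange_big /= => growth.
have : 2 ^+ d * (2 * tau * K%:R - 2 * eps)
    <= 4 * tau * (K%:R * (2 ^+ d * (2 * M * delta + eps + 4 * L * tau))).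
  apply: (le_trans growth); rewrite ler_wpM2l ?mulr_ge0 ?(ltW t0)//.
  by apply: (le_trans (ler_sum _ (fun k _ => average k)));
     rewrite sumr_const card_ord -[leLHS]mulr_natl.
rewrite (_ : 4 * tau * _ = 2 ^+ d
  * (tau * K%:R * (4 * (2 * M * delta + eps + 4 * L * tau)))); last by ring.
rewrite ler_pM2l ?exprn_gt0// => H3.
have : (tau * K%:R) * (3 / 2)
    <= (tau * K%:R) * (4 * (2 * M * delta + eps + 4 * L * tau)) by lra.
by rewrite ler_pM2l//; lra.
Qed.

End Tradeoff.

(** * From the trade-off to the growth rate of [L] *)

Section Rate.
Context {R : realType}.

Lemma sum_powers_le (I : Type) (s : seq I) (a : I -> R) (n : I -> nat) :
  exists A k, 0 <= A /\ forall B, 1 <= B ->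
    \sum_(i <- s) `|a i| * B ^+ n i <= A * B ^+ k.
Proof.
elim: s => [|i s [A [k [A0 Ak]]]].
  by exists 0, 0%N; split=> // B _; rewrite big_nil mul0r.
exists (`|a i| + A), (n i + k)%N; split=> [|B B1]; first by rewrite addr_ge0.
rewrite big_cons mulrDl lerD//.
  by rewrite ler_wpM2l// ler_weXn2l// leq_addr.
by apply: le_trans (Ak B B1) _; rewrite ler_wpM2l// ler_weXn2l// leq_addl.
Qed.

Lemma polyval3_le (p : mpoly.mpoly 3 R) : exists A k, 0 <= A /\
  forall x y z : R, 0 <= x -> 0 <= y -> 0 <= z ->
    polyval3 p x y z <= A * (1 + x + y + z) ^+ k.
Proof.
have [A [k [A0 Ak]]] := sum_powers_le (mpoly.msupp p)
  (fun m => mpoly.mcoeff m p) (fun m => mpoly.mdeg m).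
exists A, k; split=> // x y z x0 y0 z0.
set B := 1 + x + y + z; have B1 : 1 <= B by rewrite /B; lra.
have B0 : 0 < B by lra.
apply: le_trans (Ak B B1).
rewrite /polyval3 mpoly.mevalE; apply: ler_sum => m _.
apply: (le_trans (ler_norm _)); rewrite normrM ler_wpM2l//.
rewrite mpoly.mdegE -prodrXr normr_prod; apply: ler_prod => i _.
rewrite normr_ge0 normrX lerXn2r ?nnegrE ?(ltW B0)//.
case: i => -[|[|[|//]]] i3; rewrite (tnth_nth 0) /= ger0_norm// /B; lra.
Qed.

(** The tangent to [ln] at [b]: the slope [1 / b] can be made as small as
    needed to absorb a logarithm into a linear term. *)
Lemma ln_le_linear (b t : R) : 0 < b -> 0 < t -> ln t <= t / b + ln b.
Proof.
move=> b0 t0; have tb0 : 0 < t / b by rewrite divr_gt0.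
have := @le_ln1Dx R (t / b - 1); rewrite addrCA subrr addr0 => H.
have {H} : ln (t / b) <= t / b - 1 by apply: H; rewrite ltrBDr addNr.
by rewrite ln_div ?posrE//; lra.
Qed.

(** With [X = D / eps] and [q = X / L], the hypotheses bound the argument of the
    last logarithm by a constant times [(1 + q)^2 (1 + L)^2], because [D <= X]
    and [1 / eps = O(L)].  The hypothesis thus reads
    [q <= a + b ln (1 + q) + b ln (1 + L)], which [ln_le_linear] solves for [q].
    Additive constants are absorbed in [ln (L + 1)], which is bounded below
    since [8 <= 1 / eps <= 32 Cr L]. *)
Lemma growth_rate (Cr C : R) (k : nat) : 0 < Cr -> 1 <= C ->
  exists2 c : R, 0 < c & forall D L eps : R,
    0 <= D -> 0 < L -> 0 < eps -> eps <= 8^-1 -> eps^-1 <= 32 * Cr * L ->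
    D / eps <= 64 * Cr * L * (ln C + k%:R * ln (1 + D ^+ 2 + L + eps^-1)) ->
    D / eps <= c * (L * ln (L + 1)).
Proof.
move=> Cr0 C1.
pose b := 128 * Cr * k%:R + 1.
pose a := 64 * Cr * (ln C + k%:R * ln (1 + 32 * Cr)).
pose a' := 2 * a + 1 + 2 * b * ln (2 * b).
pose l0 := ln (1 + (4 * Cr)^-1).
have k0 : 0 <= k%:R :> R := ler0n _ k.
have Crk : 0 <= Cr * k%:R by rewrite mulr_ge0// ltW.
have b0 : 0 < b by rewrite /b; lra.
have Crv : 0 < (4 * Cr)^-1 by rewrite invr_gt0; lra.
have l00 : 0 < l0 by rewrite ln_gt0//; lra.
exists (`|a'| / l0 + 2 * b).
  by rewrite ltr_pwDr// ?mulr_gt0// divr_ge0// ltW.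
move=> D L eps D0 L0 e0 e8 eL; set X := D / eps => XL.
pose q := X / L.
have X0 : 0 <= X by rewrite divr_ge0// ltW.
have q0 : 0 <= q by rewrite divr_ge0// ltW.
have XE : X = q * L by rewrite /q divfK// gt_eqF.
have DX : D <= X by rewrite /X ler_pdivlMr// ler_piMr//; lra.
have L1 : (4 * Cr)^-1 <= L.
  have : 8 <= eps^-1 by rewrite -[8]invrK lef_pV2 ?posrE ?invr_gt0.
  move=> h; rewrite -[(_)^-1]mul1r ler_pdivrMr; lra.
have lL : l0 <= ln (L + 1) by rewrite ler_ln ?posrE; lra.
set B := 1 + D ^+ 2 + L + eps^-1 in XL.
have B1 : 1 <= B.
  have ev0 : 0 < eps^-1 by rewrite invr_gt0.
  by have := sqr_ge0 D; rewrite /B; lra.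
have BB : B <= (1 + 32 * Cr) * ((1 + q) ^+ 2 * (1 + L) ^+ 2).
  have : D ^+ 2 <= q ^+ 2 * L ^+ 2 by rewrite -exprMn -XE ler_sqr ?nnegrE.
  have qL : 0 <= q * L by rewrite mulr_ge0// ltW.
  have := mulr_ge0 q0 qL; have := mulr_ge0 qL (ltW L0).
  have := sqr_ge0 q; have := sqr_ge0 L; have := sqr_ge0 (q * L).
  set Z := (1 + q) ^+ 2 * (1 + L) ^+ 2.
  move=> h1 h2 h3 h4 h5 h6.
  have hZ : 1 + q ^+ 2 * L ^+ 2 + L <= Z by rewrite /Z; lra.
  have LZ : L <= Z by rewrite exprMn in h1; lra.
  have := ler_wpM2l (ltW Cr0) LZ; rewrite /B; lra.
have lnB : ln B <= ln (1 + 32 * Cr) + 2 * ln (1 + q) + 2 * ln (L + 1).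
  have p1 : 0 < 1 + 32 * Cr by lra.
  have p2 : 0 < 1 + q by lra.
  have p3 : 0 < 1 + L by lra.
  apply: (@le_trans _ _ (ln ((1 + 32 * Cr) * ((1 + q) ^+ 2 * (1 + L) ^+ 2)))).
    by rewrite ler_ln ?posrE ?mulr_gt0 ?exprn_gt0//; lra.
  rewrite lnM ?posrE ?mulr_gt0 ?exprn_gt0// lnM ?posrE ?exprn_gt0//.
  by rewrite !lnXn// (addrC 1 L) !mulr2n; lra.
have qle : q <= a + b * ln (1 + q) + b * ln (L + 1).
  have qB : q <= 64 * Cr * (ln C + k%:R * ln B).
    rewrite /q ler_pdivrMr//; apply: (le_trans XL).
    by rewrite -[leLHS]mulrA (mulrC L) mulrA.
  have u0 : 0 <= ln (1 + q) by rewrite ln_ge0//; lra.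
  have v0 : 0 <= ln (L + 1) by rewrite ln_ge0//; lra.
  have kB := ler_wpM2l Crk lnB.
  move: qB u0 v0 kB; rewrite /a /b; clear.
  move: (ln (1 + q)) (ln (L + 1)) (ln B) (ln C) (ln (1 + 32 * Cr)) => *; lra.
have b20 : 0 < 2 * b by lra.
have q10 : 0 < 1 + q by lra.
have := ler_wpM2l (ltW b0) (ln_le_linear b20 q10).
have -> : b * ((1 + q) / (2 * b) + ln (2 * b)) = (1 + q) / 2 + b * ln (2 * b).
  by field; rewrite gt_eqF.
move=> qlin.
have qa : q <= a' + 2 * b * ln (L + 1) by rewrite /a'; lra.
have : a' <= `|a'| / l0 * ln (L + 1).
  apply: (le_trans (ler_norm _)); rewrite mulrAC ler_pdivlMr//.
  by rewrite ler_wpM2l.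
move=> a'l; rewrite XE [leLHS]mulrC [leRHS]mulrCA ler_pM2l//; lra.
Qed.

End Rate.

Section Bounds.
Context {R : realType} {d : nat} {disp : measure_display}
  {Omega : measurableType disp} (P : probability Omega R) {Ans : Type}.
Variables (O : oracle R d Ans) (S : algorithm R d Omega Ans).
Variables (L eps : R) (T : nat) (M r : R).
Hypotheses (smS : smoother P O S L eps T M r) (tS : TICF O S T).
Hypotheses (d0 : (0 < d)%N) (e8 : eps <= 8^-1).

(** With [tau = 2 r] no displacement of norm at most [r] detects any
    direction. *)
Lemma radius_lower_bound : 1 <= 32 * (L * r).
Proof.
have [[L0 e0 T1 M0 r0] _ _] := smS.
have r20 : 0 < 2 * r by rewrite mulr_gt0.
suff : 4^-1 <= 2 * M * 0 + 4 * L * (2 * r) by lra.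
apply: (smoothing_tradeoff smS tS d0 r20 _ e8) => zs _ zr.
rewrite mulr0 big1// => s _.
rewrite (_ : detected _ _ _ = false)//; apply/negbTE/hasPn => z /zr zr'.
rewrite -ltNge.
have := le_trans (abs_dot_le z (signvec_unit s d0)) zr'; lra.
Qed.

(** The choice of [tau] makes the probability that one query detects a random
    direction at most [4 / Q]; the union bound over [T] queries then leaves
    [2 M delta <= 1/8]. *)
Lemma sqrt_dim_le (Q : R) : 1 < Q -> 64 * (M * T%:R) <= Q ->
  Num.sqrt d%:R <= 64 * (L * r) * ln Q.
Proof.
move=> Q1 QMT; have [[L0 e0 T1 M0 r0] _ _] := smS.
have Q0 : 0 < Q by lra.
have q0 : 0 < Num.sqrt d%:R :> R by rewrite sqrtr_gt0 ltr0n.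
pose tau := 2 * r * ln Q / Num.sqrt d%:R.
have t0 : 0 < tau by rewrite divr_gt0 ?mulr_gt0 ?ln_gt0.
have E : expR (- (tau * Num.sqrt d%:R / (2 * r))) = Q^-1.
  rewrite (_ : _ / _ = ln Q); last by rewrite /tau; field; rewrite !gt_eqF.
  by rewrite expRN lnK// posrE.
have : 4^-1 <= 2 * M * (T%:R * (4 / Q)) + 4 * L * tau.
  apply: (smoothing_tradeoff smS tS d0 t0 _ e8) => zs <- zr.
  by rewrite -E; exact: detected_rare.
have : 2 * M * (T%:R * (4 / Q)) <= 8^-1.
  rewrite (_ : _ * _ = 8 * (M * T%:R) / Q); last by ring.
  by rewrite ler_pdivrMr//; lra.
move=> h1 h2; have {h1 h2} : 8^-1 <= 4 * L * tau by lra.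
rewrite (_ : 4 * L * tau = 8 * (L * r) * ln Q / Num.sqrt d%:R); last first.
  by rewrite /tau; ring.
by rewrite ler_pdivlMr//; lra.
Qed.

End Bounds.

Theorem corollary1 (R : realType) :
  exists c2 : R, 0 < c2 /\
    forall (pT pM : mpoly.mpoly 3 R) (Cr : R), 0 < Cr ->
    exists c : R, 0 < c /\
      forall (d : nat) (L eps : R) (T : nat) (M r : R)
        (disp : measure_display) (Omega : measurableType disp)
        (P : probability Omega R) (Ans : Type)
        (O : oracle R d Ans) (S : algorithm R d Omega Ans),
        eps <= c2 / 2 ->
        smoother P O S L eps T M r ->
        TICF O S T ->
        T%:R <= polyval3 pT d%:R L eps^-1 ->
        r <= Cr * eps ->
        M <= polyval3 pM d%:R L eps^-1 ->
        Num.sqrt d%:R / eps <= c * (L * ln (L + 1)).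
Proof.
exists 4^-1; split; first by rewrite invr_gt0.
move=> pT pM Cr Cr0.
have [AT [kT [AT0 leT]]] := polyval3_le pT.
have [AM [kM [AM0 leM]]] := polyval3_le pM.
pose C := 64 * (AM * AT) + 2.
have C2 : 2 <= C by rewrite /C; have := mulr_ge0 AM0 AT0; lra.
have C1 : 1 <= C by lra.
have [c c0 rate] := growth_rate (kM + kT) Cr0 C1.
exists c; split=> // d L eps T M r disp Omega P Ans O S e8' smS tS TT rr MM.
have e8 : eps <= 8^-1 by lra.
have [[L0 e0 T1 M0 r0] _ _] := smS.
have [d0|d0] := posnP d.
  rewrite d0 sqrtr0 mul0r mulr_ge0 ?(ltW c0)// mulr_ge0 ?(ltW L0)//.
  by rewrite ln_ge0//; lra.
have ev0 : 0 < eps^-1 by rewrite invr_gt0.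
have dn : 0 <= d%:R :> R := ler0n _ d.
pose B := 1 + d%:R + L + eps^-1.
have B1 : 1 <= B by rewrite /B; lra.
have {}TT := le_trans TT (leT _ _ _ dn (ltW L0) (ltW ev0)).
have {}MM := le_trans MM (leM _ _ _ dn (ltW L0) (ltW ev0)).
rewrite -/B in TT MM.
have Bk1 : 1 <= B ^+ (kM + kT) by rewrite exprn_ege1.
have Q1 : 1 < C * B ^+ (kM + kT).
  by apply: lt_le_trans (ler_peMr _ Bk1); lra.
have QMT : 64 * (M * T%:R) <= C * B ^+ (kM + kT).
  have := ler_pM (ltW M0) (ler0n _ T) MM TT.
  rewrite mulrACA -exprD /C; lra.
have := sqrt_dim_le smS tS d0 e8 Q1 QMT.
have B0 : 0 < B by lra.
rewrite lnM ?posrE ?exprn_gt0//; last by lra.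
rewrite lnXn// -[ln B *+ _]mulr_natl => dim.
have Lr : L * r <= L * (Cr * eps) by rewrite ler_pM2l.
apply: rate => //.
- rewrite -[leLHS]mul1r ler_pdivrMr//.
  by have := radius_lower_bound smS tS d0 e8; lra.
rewrite sqr_sqrtr// -/B ler_pdivrMr//; apply: (le_trans dim).
have l0 : 0 <= ln C + (kM + kT)%:R * ln B.
  by rewrite addr_ge0 ?ln_ge0// mulr_ge0// ln_ge0.
by have := ler_wpM2r l0 Lr; lra.
Qed.
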